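(* Let $1\le p,q<\infty$ and let $\mathcal{Y}$ be a set of $\nu$-measurable functions on $X$. Suppose that there is a family $\{E_i,E_i'\}_{i\in\mathcal{I}}$ with $\mathcal{I}\subset\mathbf{N}$ such that: (B1) $E_i\subset X$ are $\nu$-measurable, $\nu\bigl(E\setminus\bigcup_{i\in\mathcal{I}}E_i\bigr)=0$, $\nu(E_i)<\infty$ for every $i\in\mathcal{I}$, and $\inf_{i\in\mathcal{I}}\nu(E_i\cap E)>0$; the sets $E_i'\subset X$ are $\mu$-measurable; (B2) there are mappings $a_{E_i}:\mathcal{Y}\to\mathbf{R}$ and $G:\mathcal{Y}\to L^p(X,\mu)$ with $G(u)\ge0$ $\mu$-a.e., and a constant $C_E$ (independent of $u$ and $i$) such that for all $u\in\mathcal{Y}$ and $i\in\mathcal{I}$, $$\biggl(\int_{E_i}|u-a_{E_i}(u)|^q\,d\nu\biggr)^{1/q}\le C_E\biggl(\int_{E_i'}G(u)^p\,d\mu\biggr)^{1/p};$$ (B3) $\displaystyle N:=\operatorname*{ess\,sup}_{x\in X}\sum_{i\in\mathcal{I}}\chi_{E_i}(x)+\operatorname*{ess\,sup}_{x\in X}\sum_{i\in\mathcal{I}}\chi_{E_i'}(x)<\infty$, where the essential suprema are taken with respect to $\nu$ and $\mu$, respectively. Assume that one of the following conditions holds: (i) the index set $\mathcal{I}$ is finite, $1\le q<\infty$ and $t\ge1$; (ii) $\mathcal{I}$ is countably infinite, $1\le p\le q<\infty$ and $1\le t<q$. Then there is $C>0$ such that for all $u\in\mathcal{Y}\cap L^t(E,\nu)$,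 $$\|u\|_{L^q(E,\nu)}\le C\bigl(\|G(u)\|_{L^p(X,\mu)}+\|u\|_{L^t(E,\nu)}\bigr).$$
   Context: $X$ is a metric space equipped with positive complete Borel measures $\mu$ and $\nu$ (not assumed finite, not even locally), and $E\subset X$ is $\nu$-measurable with $\nu(E)>0$. $\chi_A$ is the characteristic function of $A$. *)

(* Defs.v *)
From HB Require Import structures.
From mathcomp Require Import all_boot all_order all_algebra.
From mathcomp Require Import all_classical all_reals all_analysis.
From mathcomp Require Import measurable_realfun ess_sup_inf.

Set Implicit Arguments.
Unset Strict Implicit.
Unset Printing Implicit Defensive.

Import Order.TTheory GRing.Theory Num.Theory.
Import numFieldNormedType.Exports.

Local Open Scope classical_set_scope.
Local Open Scope ring_scope.
Local Open Scope ereal_scope.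

(* Metric spaces with a base point: measurable types are pointed. This excludes
   only the empty space, which carries no set of positive measure. *)
#[short(type="pmetricType")]
HB.structure Definition PointedMetric (K : numDomainType) :=
  {M of Pointed M & Metric K M}.

(* Two measures on the same space X may have different sigma-algebras of
   measurable sets, so a measure on X comes with its own sigma-algebra S and is
   carried by the copy [g_sigma_algebraType S] of X, whose measurable sets are
   exactly those of S when S is a sigma-algebra. S contains the Borel sets, and
   may be larger, as completeness requires. *)
Definition complete_borel (R : realType) (X : pmetricType R) (S : set (set X))
    (mu : {measure set (g_sigma_algebraType S) -> \bar R}) : Prop :=
  [/\ sigma_algebra [set: X] S,
      (forall A : set X, open A -> S A)
    & measure_is_complete mu].

(* Membership of (the restriction to D of) f in L^p(D, mu); f \_ D is f on D
   and 0 elsewhere, so 'N[mu]_p[f \_ D] is the norm of f in L^p(D, mu). *)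
Definition inLp d (T : measurableType d) (R : realType)
    (mu : {measure set T -> \bar R}) (D : set T) (p : R) (f : T -> \bar R) :
    Prop :=
  measurable_fun D f /\ 'N[mu]_(p%:E)[f \_ D] < +oo.

(* Essential supremum of the number of sets A i, i in I, containing a point.
   [ess_sup] is -oo when mu is the zero measure, hence the maximum with 0. *)
Definition overlap d (T : measurableType d) (R : realType)
    (mu : {measure set T -> \bar R}) (I : set nat) (A : nat -> set T) : \bar R :=
  maxe 0 (ess_sup mu (fun x => \esum_(i in I) (\1_(A i) x)%:E)).

(* Main.v *)
(* On F_i = E_i n E, write |u|^q <= 2^q (|u - a_i|^q + |a_i|^q). On at least half
   of F_i either |u - a_i| >= |a_i|/2 or |u| >= |a_i|/2, so Markov's inequality
   bounds |a_i|^q nu(F_i) by the integral of |u - a_i|^q plus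
   nu(F_i)^(1 - q/t) times the (q/t)-th power of the integral of |u|^t. Only
   F_i, and not E_i, enters here, so no upper bound on nu(E_i) is needed: in the
   infinite case 1 - q/t < 0 and nu(F_i) is bounded below. Summing over i uses
   bounded overlap together with sum x_i^r <= (sum x_i)^r for r >= 1, with
   r = q/p and r = q/t. When I is finite the sums of powers need no condition
   on r. *)
Require Import Defs.
From HB Require Import structures.
From mathcomp Require Import all_boot all_order all_algebra.
From mathcomp Require Import all_classical all_reals all_analysis.
From mathcomp Require Import measurable_realfun ess_sup_inf.
From mathcomp Require Import ring lra.

Set Implicit Arguments.
Unset Strict Implicit.
Unset Printing Implicit Defensive.

Import Order.TTheory GRing.Theory Num.Theory.
Import numFieldNormedType.Exports.

Local Open Scope classical_set_scope.
Local Open Scope ring_scope.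
Local Open Scope ereal_scope.

(** * Real powers of nonnegative extended reals *)

Section extended_powers.
Context {R : realType}.
Implicit Types (x y : \bar R) (r : R).

Lemma ge0_le_poweR r x y : (0 <= r)%R -> 0 <= x -> x <= y -> x `^ r <= y `^ r.
Proof.
move=> r0 x0 xy.
by apply: gt0_ler_poweR => //; rewrite in_itv/= leey andbT// (le_trans x0).
Qed.

(** A sum is at most twice the maximum, and the power of the maximum is one of the two summands on
    the right; this covers all [r >= 0], with no case split on convexity. *)
Lemma poweRD_le x y r : (0 <= r)%R -> 0 <= x -> 0 <= y ->
  (x + y) `^ r <= (2 `^ r)%:E * (x `^ r + y `^ r).
Proof.
move=> r0 x0 y0.
have xy : x + y <= 2%:E * maxe x y.
  by rewrite mule_natl mule2n leeD// le_max lexx ?orbT.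
have m0 : 0 <= maxe x y by rewrite le_max x0.
rewrite (le_trans (ge0_le_poweR r0 _ xy)) ?adde_ge0//.
rewrite poweRM// poweR_EFin lee_wpmul2l ?lee_fin ?powR_ge0//.
by rewrite /maxe; case: ifP => _; rewrite ?leeDl ?leeDr ?poweR_ge0.
Qed.

End extended_powers.

(** * Integrals over a family of sets: covering and bounded overlap *)

Section sums_over_families.
Context d (T : measurableType d) (R : realType) (m : {measure set T -> \bar R}).
Variables (I : set nat) (A : nat -> set T) (f : T -> \bar R).
Hypothesis mA : forall i, I i -> measurable (A i).
Hypothesis mf : measurable_fun [set: T] f.
Hypothesis f0 : forall x, 0 <= f x.

Let restr0 i x : 0 <= (f \_ (A i)) x.
Proof. by rewrite patchE; case: ifP. Qed.

(** Extension by zero moves all integrals to the common domain [T], where a series of nonnegative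
    functions may be integrated termwise. *)
Lemma nneseries_integral_restrict :
  \sum_(i <oo | i \in I) \int[m]_(x in A i) f x
  = \int[m]_x \sum_(i <oo | i \in I) (f \_ (A i)) x.
Proof.
rewrite eseries_mkcond.
rewrite [RHS](eq_integral (fun x =>
  \sum_(i <oo) if i \in I then (f \_ (A i)) x else 0)); last first.
  by move=> x _; exact: eseries_mkcond.
rewrite integral_nneseries//.
- apply: eq_eseriesr => i _; case: ifPn => iI; rewrite ?integral0//.
  exact: integral_mkcond.
- move=> i; have [iI|iI] := boolP (i \in I); first last.
    exact: measurable_cst.
  apply/(measurable_restrictT _ (mA _)); first by rewrite inE in iI.
  exact: measurable_funTS.
- by move=> i x _; case: ifP.
Qed.

Let mseries : measurable_fun [set: T]
  (fun x => \sum_(i <oo | i \in I) (f \_ (A i)) x).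
Proof.
apply: ge0_emeasurable_sum => // i iI.
apply/(measurable_restrictT _ (mA _)); first by rewrite inE in iI.
exact: measurable_funTS.
Qed.

Lemma integral_le_cover (D : set T) : measurable D ->
  m (D `\` \bigcup_(i in I) A i) = 0 ->
  \int[m]_(x in D) f x <= \sum_(i <oo | i \in I) \int[m]_(x in A i) f x.
Proof.
move=> mD D0; rewrite nneseries_integral_restrict integral_mkcond.
apply: ae_ge0_le_integral => //.
- by move=> x _; rewrite patchE; case: ifP.
- by apply/(measurable_restrictT _ mD); exact: measurable_funTS.
- by move=> x _; exact: nneseries_ge0.
(* The exceptional set is the uncovered part of [D]: off [D] the restriction vanishes, and at a
   point of some [A i] the single term of index [i] already equals [f x]. *)
exists (D `\` \bigcup_(i in I) A i); split => //.
  by apply: measurableD => //; exact: bigcup_measurable.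
move=> x /= /not_implyP[_] fx; split.
  by apply: contrapT => nD; apply: fx; rewrite patchE memNset// nneseries_ge0.
move=> [i Ii Aix]; apply: fx.
rewrite (@nneseriesD1 _ _ i)//; last by rewrite inE.
rewrite [X in _ <= X + _]patchE mem_set//.
apply: (@le_trans _ _ (f x)); first by rewrite patchE; case: ifP.
by rewrite leeDl// nneseries_ge0.
Qed.

(** At each point the series of restrictions is [f x] times the number of sets containing [x], and
    almost everywhere this number is at most the overlap. *)
Lemma nneseries_integral_le_overlap : overlap m I A < +oo ->
  \sum_(i <oo | i \in I) \int[m]_(x in A i) f x
  <= (fine (overlap m I A) + 1)%:E * \int[m]_x f x.
Proof.
move=> Noo.
have N0 : 0 <= overlap m I A by rewrite /overlap le_max lexx.
have Nfin : overlap m I A \is a fin_num by rewrite ge0_fin_numE.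
rewrite nneseries_integral_restrict -ge0_integralZl_EFin//; last first.
  by rewrite addr_ge0// fine_ge0.
apply: ae_ge0_le_integral => //.
- by move=> x _; exact: nneseries_ge0.
- by move=> x _; rewrite mule_ge0// lee_fin addr_ge0// fine_ge0.
- by apply: measurable_funeM.
have := ess_sup_ge m (fun x => \esum_(i in I) (\1_(A i) x)%:E : \bar R).
apply: filterS => x /= Hx _.
have {}Hx : \esum_(i in I) (\1_(A i) x)%:E <= overlap m I A.
  by rewrite (le_trans Hx)// /overlap le_max lexx orbT.
(* The 1 added to the overlap makes the constant positive, so where [f] is infinite the right-hand
   side is [+oo] even if the overlap is 0. *)
have [fxoo|fxoo] := eqVneq (f x) +oo.
  by rewrite fxoo gt0_muley ?leey// lte_fin ltr_wpDl// fine_ge0.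
have fxfin : f x \is a fin_num by rewrite ge0_fin_numE// ltey.
rewrite EFinD fineK// muleDl//; last by rewrite fin_num_adde_defr.
rewrite mul1e (@le_trans _ _ (overlap m I A * f x))//; last by rewrite leeDl.
rewrite muleC -(fineK fxfin).
apply: le_trans (lee_wpmul2l _ Hx); last by rewrite fineK.
rewrite -[I in X in _ <= X]set_mem_set -nneseries_esum//.
rewrite -nneseriesZl//.
apply: lee_nneseries => // i _.
rewrite patchE indicE; case: ifP => _; rewrite ?mule1 ?mule0//.
by rewrite fineK.
Qed.

End sums_over_families.

(** * Sums of powers of integrals over a family *)

Section powers_of_integrals.
Context {R : realType}.
Implicit Types (I : set nat).

(** Each [x i] is at most [S], so its [r]-th power is at most $S^{r-1} x_i$; summation gives
    $S^{r-1} S = S^r$. *)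
Lemma nneseries_poweR_le I (x : nat -> \bar R) (S : \bar R) (r : R) : (1 <= r)%R ->
  (forall i, 0 <= x i) -> \sum_(i <oo | i \in I) x i <= S ->
  \sum_(i <oo | i \in I) (x i) `^ r <= S `^ r.
Proof.
move=> r1 x0 xS; have r0 : (0 < r)%R by rewrite (lt_le_trans _ r1).
have S0 : 0 <= S by rewrite (le_trans _ xS)// nneseries_ge0.
case: S S0 xS => [s| |]// S0 xS; last by rewrite poweRyr ?gt_eqF// leey.
rewrite lee_fin in S0.
apply: (@le_trans _ _ (\sum_(i <oo | i \in I) (s `^ (r - 1))%:E * x i)).
  apply: lee_nneseries => [i _ _|i iI]; first exact: poweR_ge0.
  have xi : x i <= s%:E.
    by rewrite (le_trans _ xS)// (@nneseriesD1 _ _ i)// leeDl// nneseries_ge0.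
  case: (x i) (x0 i) xi => [y| |]//; rewrite !lee_fin => y0 ys.
  rewrite -mulr_powRB1// mulrC ler_wpM2r//.
  by rewrite ge0_ler_powR// subr_ge0.
rewrite nneseriesZl// poweR_EFin -(mulr_powRB1 S0 r0) mulrC EFinM.
by rewrite lee_wpmul2l// lee_fin powR_ge0.
Qed.

Context d (T : measurableType d) (m : {measure set T -> \bar R}).

(** The weights allow two uses: weight 1 for the gradient term, and powers of $\nu(E_i\cap E)$ for
    the lower-order term. For finite [I] each integral is at most the full one; otherwise the
    weights are bounded and [nneseries_poweR_le] is applied to the overlap bound. *)
Lemma nneseries_integral_poweR_le I (A : nat -> set T) (k : nat -> R) (r : R) :
  (forall i, I i -> measurable (A i)) -> overlap m I A < +oo ->
  (forall i, 0 <= k i)%R -> (0 < r)%R ->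
  finite_set I \/ (1 <= r)%R /\ (exists M, forall i, I i -> k i <= M)%R ->
  exists2 K : R, (0 <= K)%R & forall f : T -> \bar R,
    measurable_fun [set: T] f -> (forall x, 0 <= f x) ->
    \sum_(i <oo | i \in I) (k i)%:E * (\int[m]_(x in A i) f x) `^ r
    <= K%:E * (\int[m]_x f x) `^ r.
Proof.
move=> mA Noo k0 r0 [finI|[r1 [M kM]]].
  exists (\sum_(i \in I) k i)%R => [|f mf f0].
    by rewrite fsbig_finite//=; exact: sumr_ge0.
  have t0 i : 0 <= (k i)%:E * (\int[m]_(x in A i) f x) `^ r.
    by rewrite mule_ge0 ?lee_fin ?poweR_ge0.
  rewrite nneseries_esum// set_mem_set esum_fset// !fsbig_finite//=.
  rewrite -sumEFin ge0_sume_distrl//; last by move=> i _; rewrite lee_fin.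
  rewrite big_seq [leRHS]big_seq; apply: lee_sum => i.
  rewrite in_fset_set// inE => Ii.
  rewrite lee_wpmul2l ?lee_fin// ge0_le_poweR ?(ltW r0) ?integral_ge0//.
  by apply: ge0_subset_integral => //; exact: mA.
set N := (fine (overlap m I A) + 1)%R.
have N0 : (0 <= N)%R.
  by rewrite addr_ge0// fine_ge0// /overlap le_max lexx.
(* The absolute value keeps the constant nonnegative when [I] is empty, as [M] may then be
   negative. *)
exists (`|M| * N `^ r)%R => [|f mf f0]; first by rewrite mulr_ge0// powR_ge0.
have int0 D : 0 <= \int[m]_(x in D) f x by exact: integral_ge0.
apply: (@le_trans _ _
  (\sum_(i <oo | i \in I) `|M|%:E * (\int[m]_(x in A i) f x) `^ r)).
  apply: lee_nneseries => [i _ _|i /set_mem Ii].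
    by rewrite mule_ge0 ?lee_fin ?poweR_ge0.
  by rewrite lee_wpmul2r ?poweR_ge0// lee_fin (le_trans (kM _ Ii))// ler_norm.
rewrite nneseriesZl; last by move=> i _; exact: poweR_ge0.
rewrite EFinM -muleA lee_wpmul2l ?lee_fin//.
rewrite -poweR_EFin -poweRM//.
apply: nneseries_poweR_le => //.
exact: nneseries_integral_le_overlap.
Qed.

End powers_of_integrals.

(** * Local estimate on one set of finite measure *)

Section local_estimate.
Context d (T : measurableType d) (R : realType) (m : {measure set T -> \bar R}).
Variables (F : set T) (q t : R).
Hypothesis mF : measurable F.
Hypothesis finF : m F < +oo.
Hypotheses (q0 : (0 < q)%R) (t0 : (0 < t)%R).

Let markov_poweR (r b : R) (g : T -> \bar R) : (0 < r)%R -> (0 < b)%R ->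
  measurable_fun F g ->
  (b `^ r)%:E * m (F `&` [set x | b%:E <= `|g x|])
  <= \int[m]_(x in F) `|g x| `^ r.
Proof.
move=> r0 b0 mg.
apply: (@le_integral_comp_abse _ _ _ m F mF g b (fun x => x `^ r)) => //.
- exact: measurable_poweR.
- by move=> x _; exact: poweR_ge0.
move=> x y; rewrite !inE/= !in_itv/= => /andP[x0 _] _.
exact: ge0_le_poweR (ltW r0) x0.
Qed.

(* On F either |u - c| >= |c|/2 on a subset of at least half the measure, or
   |u| >= |c|/2 does; Markov's inequality bounds |c| in both cases. *)
Lemma cst_le_integral (u : T -> \bar R) (c : R) : measurable_fun F u ->
  ((`|c| `^ q)%:E * m F <=
    (2 `^ q * (2 + 2 `^ (q / t)))%:E *
    (\int[m]_(x in F) `|u x - c%:E| `^ q +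
     (fine (m F) `^ (1 - q / t))%:E *
       (\int[m]_(x in F) `|u x| `^ t) `^ (q / t))).
Proof.
move=> mu; set J := integral _ _ _; set L := integral _ _ (fun x => `|u x| `^ t).
set s := (q / t)%R; have s0 : (0 < s)%R by rewrite divr_gt0.
have J0 : 0 <= J by apply: integral_ge0 => x _; exact: poweR_ge0.
have L0 : 0 <= L by apply: integral_ge0 => x _; exact: poweR_ge0.
have mFfin : m F \is a fin_num by rewrite ge0_fin_numE.
set k := (fine (m F) `^ (1 - s))%:E.
have k0 : 0 <= k by rewrite lee_fin powR_ge0.
have RHS0 : 0 <= (2 `^ q * (2 + 2 `^ s))%:E * (J + k * L `^ s).
  apply: mule_ge0; first by rewrite lee_fin mulr_ge0 ?addr_ge0 ?powR_ge0.
  by rewrite adde_ge0// mule_ge0 ?poweR_ge0.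
have [->|c0] := eqVneq c 0%R.
  by rewrite normr0 powR0 ?gt_eqF// mul0e.
have b0 : (0 < `|c| / 2)%R by rewrite divr_gt0// normr_gt0.
have mc : measurable_fun F (fun x => u x - c%:E).
  by apply: emeasurable_funB => //; exact: measurable_cst.
have HA := markov_poweR q0 b0 mc.
have HB := markov_poweR t0 b0 mu.
set A := F `&` _ in HA; set B := F `&` _ in HB.
have level (g : T -> \bar R) : measurable_fun F g ->
    measurable (F `&` [set x | (`|c| / 2)%:E <= `|g x|]).
  move=> mg; apply: emeasurable_fun_c_infty => //.
  exact: measurableT_comp.
have mFAB : m F <= m A + m B.
  apply: (@le_trans _ _ (m (A `|` B))); last first.
    by apply: measureU2; exact: level.
  apply: le_measure; rewrite ?inE//.
    by apply: measurableU; exact: level.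
  move=> x Fx; have [h|h] := leP (`|c| / 2)%:E `|u x|; [by right|left; split=> //=].
  move: h; case: (u x) => [y| |]//=.
  rewrite !lte_fin !lee_fin => h.
  have := ler_normD (c - y)%R y; rewrite subrK (distrC y) => h'.
  lra.
have cq : (`|c| `^ q = 2 `^ q * (`|c| / 2) `^ q)%R.
  by rewrite -powRM// ?divr_ge0// mulrC divfK.
have [HF|HF] := leP (m F) (2%:E * m A).
  apply: (@le_trans _ _ ((2 `^ q * 2)%:E * J)).
    rewrite cq !EFinM -!muleA lee_wpmul2l ?lee_fin ?powR_ge0//.
    apply: (@le_trans _ _ (((`|c| / 2) `^ q)%:E * (2%:E * m A))).
      by rewrite lee_wpmul2l ?lee_fin ?powR_ge0.
    by rewrite muleCA lee_wpmul2l.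
  apply: lee_pmul => //.
  - by rewrite lee_fin ler_wpM2l ?powR_ge0// lerDl powR_ge0.
  - by rewrite leeDl// mule_ge0// poweR_ge0.
(* Now [A] carries less than half of [m F]; since all measures are finite, subtraction leaves at
   least half for [B]. *)
have {HF} HF : m F <= 2%:E * m B.
  have fin C : measurable C -> C `<=` F -> m C \is a fin_num.
    move=> mC CF; rewrite ge0_fin_numE// (le_lt_trans _ finF)//.
    by apply: le_measure; rewrite ?inE.
  have finA : m A \is a fin_num by apply: fin; [exact: level|exact: subIsetl].
  have finB : m B \is a fin_num by apply: fin; [exact: level|exact: subIsetl].
  move: HF mFAB; rewrite -(fineK mFfin) -(fineK finA) -(fineK finB).
  by rewrite -EFinM lte_fin -EFinD -EFinM !lee_fin; lra.
set w := fine (m F); have w0 : (0 <= w)%R by exact: fine_ge0.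
(* Markov's inequality on [B], raised to the power [s = q / t] to turn the exponent [t] of [|c| / 2]
   into [q]. *)
have Ls : (((`|c| / 2) `^ t * (w / 2)) `^ s)%:E <= L `^ s.
  rewrite -poweR_EFin; apply: ge0_le_poweR (ltW s0) _ _.
    by rewrite lee_fin mulr_ge0 ?powR_ge0 ?divr_ge0.
  apply: le_trans HB; rewrite EFinM lee_wpmul2l ?lee_fin ?powR_ge0//.
  by rewrite mulrC EFinM fineK// lee_pdivrMl.
apply: (@le_trans _ _ ((2 `^ q * 2 `^ s)%:E * (k * L `^ s))).
  apply: (@le_trans _ _ ((2 `^ q * 2 `^ s)%:E *
      (k * (((`|c| / 2) `^ t * (w / 2)) `^ s)%:E))).
    rewrite -(fineK mFfin) -/w /k -!EFinM lee_fin cq.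
    have -> : (((`|c| / 2) `^ t * (w / 2)) `^ s =
        (`|c| / 2) `^ q * (w `^ s * 2^-1 `^ s))%R.
      rewrite powRM ?powR_ge0 ?divr_ge0// -powRrM.
      by rewrite [(t * s)%R]mulrC divfK ?gt_eqF// (@powRM _ w) ?invr_ge0.
    (* The weight [k] is chosen for this identity, which restores the first power of [m F]. It holds
       also for [w = 0], since the exponents add up to 1. *)
    have ww : (w `^ (1 - s) * w `^ s = w)%R.
      by rewrite -powRD ?subrK ?oner_eq0 ?powRr1.
    have tt : (2 `^ s * 2^-1 `^ s = 1 :> R)%R.
      by rewrite -powRM ?invr_ge0// mulfV// powR1.
    rewrite [leLHS](_ : _ = (2 `^ q * (`|c| / 2) `^ q * (w `^ (1 - s) * w `^ s)
      * (2 `^ s * 2^-1 `^ s))%R); last by rewrite ww tt mulr1.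
    by rewrite le_eqVlt; apply/orP; left; apply/eqP; ring.
  by rewrite !lee_wpmul2l// lee_fin mulr_ge0 ?powR_ge0.
apply: lee_pmul => //.
- by rewrite mule_ge0 ?poweR_ge0.
- by rewrite lee_fin ler_wpM2l ?powR_ge0// lerDr.
- by rewrite leeDr.
Qed.

(** Integrating the [q]-th power of $|u|\le|u-c|+|c|$ leaves the term $|c|^q m(F)$, which
    [cst_le_integral] absorbs into the two terms on the right. *)
Lemma integral_le_oscillation (u : T -> \bar R) (c : R) : measurable_fun F u ->
  \int[m]_(x in F) `|u x| `^ q <=
    (2 `^ q * (1 + 2 `^ q * (2 + 2 `^ (q / t))))%:E *
    (\int[m]_(x in F) `|u x - c%:E| `^ q +
     (fine (m F) `^ (1 - q / t))%:E *
       (\int[m]_(x in F) `|u x| `^ t) `^ (q / t)).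
Proof.
move=> mu; have := cst_le_integral c mu.
set J := integral _ _ _; set W := _ * _ `^ _ => H.
have J0 : 0 <= J by apply: integral_ge0 => x _; exact: poweR_ge0.
have W0 : 0 <= W by rewrite mule_ge0 ?poweR_ge0// lee_fin powR_ge0.
have mJ : measurable_fun F (fun x => `|u x - c%:E| `^ q).
  apply: (measurableT_comp (measurable_poweR q)).
  apply: measurableT_comp => //.
  by apply: emeasurable_funB => //; exact: measurable_cst.
apply: (@le_trans _ _ ((2 `^ q)%:E * (J + (`|c| `^ q)%:E * m F))).
  have c0 : 0 <= (`|c| `^ q)%:E by rewrite lee_fin powR_ge0.
  have g0 x : 0 <= `|u x - c%:E| `^ q + (`|c| `^ q)%:E.
    by rewrite adde_ge0// poweR_ge0.
  have mg : measurable_fun F (fun x => `|u x - c%:E| `^ q + (`|c| `^ q)%:E).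
    exact: emeasurable_funD.
  rewrite -integral_cst// -ge0_integralD//; last by move=> x _; exact: poweR_ge0.
  rewrite -ge0_integralZl_EFin ?powR_ge0//.
  apply: ge0_le_integral => //.
  - by move=> x _; exact: poweR_ge0.
  - apply: (measurableT_comp (measurable_poweR q)); exact: measurableT_comp.
  - exact: measurable_funeM.
  move=> x _; rewrite -poweR_EFin -abse_EFin.
  apply: le_trans (poweRD_le (ltW q0) _ _) => //.
  apply: ge0_le_poweR (ltW q0) _ _ => //.
  (* Subtracting and adding [c] is legitimate even where [u x] is infinite, because [c] is
     finite. *)
  rewrite -[in leLHS](@subeK _ (u x) c%:E)//.
  exact: lee_abs_add.
rewrite EFinM -muleA lee_wpmul2l ?lee_fin ?powR_ge0//.
rewrite EFinD ge0_muleDl ?lee_fin ?mulr_ge0 ?addr_ge0 ?powR_ge0//.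
by rewrite mul1e leeD// leeDl.
Qed.

End local_estimate.

(** * From local to global: summing the local estimates over the family *)

Theorem theorem2p6 (R : realType) (X : pmetricType R)
    (Smu Snu : set (set X))
    (mu : {measure set (g_sigma_algebraType Smu) -> \bar R})
    (nu : {measure set (g_sigma_algebraType Snu) -> \bar R})
    (mu_borel : complete_borel mu) (nu_borel : complete_borel nu)
    (E : set X) (mE : Snu.-sigma.-measurable E) (nuE_gt0 : 0 < nu E)
    (p q t : R) (p_ge1 : (1 <= p)%R) (q_ge1 : (1 <= q)%R)
    (Y : set (X -> \bar R))
    (mY : forall u, Y u ->
       measurable_fun [set: g_sigma_algebraType Snu] u)
    (I : set nat) (E_ E'_ : nat -> set X)
    (* (B1) *)
    (mE_ : forall i, I i -> Snu.-sigma.-measurable (E_ i))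
    (E_cover : nu (E `\` \bigcup_(i in I) E_ i) = 0)
    (E_fin : forall i, I i -> nu (E_ i) < +oo)
    (E_inf : 0 < ereal_inf [set nu (E_ i `&` E) | i in I])
    (mE'_ : forall i, I i -> Smu.-sigma.-measurable (E'_ i))
    (* (B2) *)
    (a : nat -> (X -> \bar R) -> R) (G : (X -> \bar R) -> (X -> \bar R))
    (CE : R)
    (GLp : forall u, Y u ->
       @inLp _ (g_sigma_algebraType Smu) R mu [set: X] p (G u))
    (G_ge0 : forall u, Y u -> {ae mu, forall x, 0 <= G u x})
    (poincare : forall u i, Y u -> I i ->
       (\int[nu]_(x in E_ i) `|u x - (a i u)%:E| `^ q) `^ q^-1
       <= CE%:E * (\int[mu]_(x in E'_ i) (G u x) `^ p) `^ p^-1)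
    (* (B3) *)
    (N_fin : overlap nu I E_ + overlap mu I E'_ < +oo)
    (* (i) or (ii) *)
    (cases : (finite_set I /\ (1 <= t)%R) \/
             (infinite_set I /\ (p <= q)%R /\ (1 <= t < q)%R)) :
  exists C : R, (0 < C)%R /\
    forall u, Y u -> @inLp _ (g_sigma_algebraType Snu) R nu E t u ->
      'N[nu]_(q%:E)[u \_ E]
      <= C%:E * ('N[mu]_(p%:E)[G u] + 'N[nu]_(t%:E)[u \_ E]).
Proof.
have q0 : (0 < q)%R by rewrite (lt_le_trans _ q_ge1).
have p0 : (0 < p)%R by rewrite (lt_le_trans _ p_ge1).
have t0 : (0 < t)%R.
  by case: cases => [[_]|[_ [_ /andP[t1 _]]]]; apply: lt_le_trans.
(* Both overlaps are nonnegative, thanks to the maximum with 0 in their definition, so finiteness of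
   the sum passes to each. *)
have [Nnu Nmu] : overlap nu I E_ < +oo /\ overlap mu I E'_ < +oo.
  have o0 d (T : measurableType d) (m : {measure set T -> \bar R}) A :
    0 <= overlap m I A by rewrite /overlap le_max lexx.
  by split; apply: (le_lt_trans _ N_fin); rewrite ?leeDl ?leeDr.
set F := fun i => E_ i `&` E.
have mF i : I i -> Snu.-sigma.-measurable (F i).
  by move=> Ii; apply: measurableI => //; exact: mE_.
have F_inf i : I i -> ereal_inf [set nu (E_ i `&` E) | i in I] <= nu (F i).
  by move=> Ii; apply: ereal_inf_lbound; exists i.
have F_fin i : I i -> nu (F i) < +oo.
  move=> Ii; apply: (@le_lt_trans _ _ (nu (E_ i))); last exact: E_fin.
  by apply: le_measure; rewrite ?inE; [exact: mF|exact: mE_|exact: subIsetl].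
pose k i := (fine (nu (F i)) `^ (1 - q / t))%R.
have k0 i : (0 <= k i)%R by exact: powR_ge0.
have [K1 K1_ge0 HK1] : exists2 K : R, (0 <= K)%R &
    forall f : g_sigma_algebraType Smu -> \bar R,
    measurable_fun [set: g_sigma_algebraType Smu] f -> (forall x, 0 <= f x) ->
    \sum_(i <oo | i \in I) 1%:E * (\int[mu]_(x in E'_ i) f x) `^ (q / p)
    <= K%:E * (\int[mu]_x f x) `^ (q / p).
  apply: (@nneseries_integral_poweR_le _ _ _ mu I E'_ (fun=> 1%R)) => //.
    by rewrite divr_gt0.
  case: cases => [[finI _]|[_ [pq _]]]; [by left|right; split].
    by rewrite ler_pdivlMr// mul1r.
  by exists 1%R.
have [K2 K2_ge0 HK2] : exists2 K : R, (0 <= K)%R &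
    forall f : g_sigma_algebraType Snu -> \bar R,
    measurable_fun [set: g_sigma_algebraType Snu] f -> (forall x, 0 <= f x) ->
    \sum_(i <oo | i \in I) (k i)%:E * (\int[nu]_(x in E_ i) f x) `^ (q / t)
    <= K%:E * (\int[nu]_x f x) `^ (q / t).
  apply: nneseries_integral_poweR_le => //; first by rewrite divr_gt0.
  case: cases => [[finI _]|[_ [_ /andP[_ tq]]]]; [by left|right].
  have s1 : (1 <= q / t)%R by rewrite ler_pdivlMr// mul1r ltW.
  split => //.
  (* The exponent [1 - q / t] is at most 0, so the weights are largest where [nu (F i)] is smallest.
     The infimum is positive by (B1), and finite because it is at most [nu (F i)] for any [i] in
     [I]. *)
  exists ((fine (ereal_inf [set nu (E_ i `&` E) | i in I])) `^ (1 - q / t))%R.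
  move=> i Ii; have nuF_ge := F_inf _ Ii; have nuF_lt := F_fin _ Ii.
  set n0 := ereal_inf _ in E_inf nuF_ge *.
  have n0_fin : n0 \is a fin_num.
    by rewrite ge0_fin_numE ?(ltW E_inf)// (le_lt_trans nuF_ge).
  have f0 : (0 < fine n0)%R by rewrite fine_gt0// E_inf ltey_eq n0_fin.
  have fle : (fine n0 <= fine (nu (F i)))%R by rewrite fine_le// ge0_fin_numE.
  rewrite /k -opprB !powRN lef_pV2 ?posrE ?powR_gt0 ?(lt_le_trans f0)//.
  by rewrite ge0_ler_powR ?subr_ge0// nnegrE ltW// (lt_le_trans f0).
pose B := (2 `^ q * (1 + 2 `^ q * (2 + 2 `^ (q / t))))%R.
have B0 : (0 <= B)%R by rewrite !mulr_ge0 ?addr_ge0 ?mulr_ge0 ?addr_ge0 ?powR_ge0.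
pose M := (B * (`|CE| `^ q * K1 + K2))%R.
have M0 : (0 <= M)%R by rewrite mulr_ge0// addr_ge0// mulr_ge0// powR_ge0.
(* The factor 2 comes from $g^q+w^q\le 2(g+w)^q$; the summand 1 makes the constant positive even if
   [M] is 0. *)
exists ((2 * M) `^ q^-1 + 1)%R; split; first by rewrite ltr_wpDl ?powR_ge0.
move=> u Yu [_ _].
set v := u \_ E; set g := 'N[mu]_(p%:E)[G u]; set w := 'N[nu]_(t%:E)[v].
have g0 : 0 <= g by exact: Lnorm_ge0.
have w0 : 0 <= w by exact: Lnorm_ge0.
have mu_ : measurable_fun [set: g_sigma_algebraType Snu] u by exact: mY.
have mv : measurable_fun [set: g_sigma_algebraType Snu] v.
  by apply/(measurable_restrictT _ mE); exact: measurable_funTS.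
have [mG _] := GLp _ Yu.
have mabs d (T : measurableType d) (h : T -> \bar R) r :
    measurable_fun [set: T] h -> measurable_fun [set: T] (fun x => `|h x| `^ r).
  move=> mh; apply: (measurableT_comp (measurable_poweR r)).
  exact: measurableT_comp.
(* Passing from [u] to [v] replaces [F i] by [E_ i], the sets with controlled overlap. Outside [E]
   the new integrand is zero because [r] is positive. *)
have vE r (i : nat) : (0 < r)%R ->
    \int[nu]_(x in F i) `|u x| `^ r = \int[nu]_(x in E_ i) `|v x| `^ r.
  move=> r0; rewrite integral_mkcondr; apply: eq_integral => x _.
  rewrite /v !patchE; case: ifP => // _.
  by rewrite abse0 poweR0r// gt_eqF.
have poincare_q i : I i ->
    \int[nu]_(x in F i) `|u x - (a i u)%:E| `^ q <=
    (`|CE| `^ q)%:E * (\int[mu]_(x in E'_ i) `|G u x| `^ p) `^ (q / p).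
  move=> Ii; have mEi := mE_ _ Ii; have mE'i := mE'_ _ Ii.
  have muc : measurable_fun [set: g_sigma_algebraType Snu]
      (fun x => `|u x - (a i u)%:E| `^ q).
    by apply: mabs; apply: emeasurable_funB => //; exact: measurable_cst.
  apply: (@le_trans _ _ (\int[nu]_(x in E_ i) `|u x - (a i u)%:E| `^ q)).
    apply: ge0_subset_integral => //; first exact: mF.
    - exact: measurable_funTS.
    - by move=> x _; exact: poweR_ge0.
    - exact: subIsetl.
  (* [G u] is nonnegative only almost everywhere, whereas its norm is defined through the absolute
     value; the two integrals agree. *)
  have GE : \int[mu]_(x in E'_ i) (G u x) `^ p =
            \int[mu]_(x in E'_ i) `|G u x| `^ p.
    apply: ge0_ae_eq_integral => //.
    - apply: measurable_funTS; apply: (measurableT_comp (measurable_poweR p)).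
      exact: mG.
    - by apply: measurable_funTS; apply: mabs.
    - by move=> x _; exact: poweR_ge0.
    - by move=> x _; exact: poweR_ge0.
    have [N [mN N0 GN]] := G_ge0 _ Yu; exists N; split => // x nx.
    by apply: GN => Gx; apply: nx => _ /=; rewrite gee0_abs.
  have := poincare _ _ Yu Ii; rewrite GE.
  set J := integral _ _ _; set H := integral _ _ _ => JH.
  have J0 : 0 <= J by apply: integral_ge0 => x _; exact: poweR_ge0.
  (* [J] is written as the [q]-th power of its [q]-th root, to which (B2) applies; [CE] has no
     prescribed sign, hence its absolute value. *)
  rewrite -[J]poweRe1// -(mulVf (lt0r_neq0 q0)) (poweRrM J).
  apply: (@le_trans _ _ ((`|CE|%:E * H `^ p^-1) `^ q)).
    apply: ge0_le_poweR (ltW q0) (poweR_ge0 _ _) _.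
    by rewrite (le_trans JH)// lee_wpmul2r ?poweR_ge0// lee_fin ler_norm.
  by rewrite poweRM ?poweR_ge0// poweR_EFin -poweRrM mulrC.
have powN d (T : measurableType d) (m : {measure set T -> \bar R}) h r :
    (0 < r)%R -> (\int[m]_x `|h x| `^ r) `^ (q / r) = 'N[m]_(r%:E)[h] `^ q.
  move=> r0; rewrite -poweR_Lnorm ?gt_eqF// -poweRrM mulrC divfK//.
  by rewrite gt_eqF.
have sumle : \int[nu]_x `|v x| `^ q <= M%:E * (g `^ q + w `^ q).
  have -> : \int[nu]_x `|v x| `^ q = \int[nu]_(x in E) `|v x| `^ q.
    rewrite [RHS]integral_mkcond; apply: eq_integral => x _.
    by rewrite /v !patchE; case: ifP => // _; rewrite abse0 poweR0r// gt_eqF.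
  have v0 r x : 0 <= `|v x| `^ r by exact: poweR_ge0.
  apply: (le_trans (@integral_le_cover _ (g_sigma_algebraType Snu) R nu I E_
    (fun x => `|v x| `^ q) mE_ (mabs _ _ _ q mv) (v0 q) E mE E_cover)).
  have int0 d (T : measurableType d) (m : {measure set T -> \bar R}) D h r :
    0 <= \int[m]_(x in D) `|h x| `^ r.
    by apply: integral_ge0 => x _; exact: poweR_ge0.
  pose X1 i := 1%:E * (\int[mu]_(x in E'_ i) `|G u x| `^ p) `^ (q / p).
  pose X2 i := (k i)%:E * (\int[nu]_(x in E_ i) `|v x| `^ t) `^ (q / t).
  have X1_ge0 i : 0 <= X1 i by rewrite mule_ge0 ?poweR_ge0// lee_fin.
  have X2_ge0 i : 0 <= X2 i by rewrite mule_ge0 ?poweR_ge0// lee_fin.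
  have cX1_ge0 i : 0 <= (`|CE| `^ q)%:E * X1 i.
    by rewrite mule_ge0// lee_fin powR_ge0.
  (* Termwise, the local estimate on [F i] with [c = a i u], whose oscillation term is then bounded
     by [poincare_q]. *)
  apply: (@le_trans _ _ (\sum_(i <oo | i \in I)
      B%:E * ((`|CE| `^ q)%:E * X1 i + X2 i))).
    apply: lee_nneseries => [i _ _|i /set_mem Ii]; first exact: int0.
    rewrite -vE//.
    apply: (le_trans (integral_le_oscillation (mF _ Ii) (F_fin _ Ii) q0 t0
      (a i u) (measurable_funTS mu_))).
    rewrite lee_wpmul2l ?lee_fin// leeD//; last by rewrite vE.
    by rewrite /X1 mul1e; exact: poincare_q.
  rewrite nneseriesZl; last by move=> i _; rewrite adde_ge0.
  rewrite /M (EFinM B) -muleA lee_wpmul2l ?lee_fin//.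
  rewrite nneseriesD// nneseriesZl// EFinD.
  have S1 : \sum_(i <oo | i \in I) X1 i <= K1%:E * g `^ q.
    by rewrite /g -powN//; apply: HK1 => [|x]; [exact: mabs|exact: poweR_ge0].
  have S2 : \sum_(i <oo | i \in I) X2 i <= K2%:E * w `^ q.
    by rewrite /w -powN//; apply: HK2 => [|x]; [exact: mabs|exact: poweR_ge0].
  apply: (@le_trans _ _
      ((`|CE| `^ q)%:E * (K1%:E * g `^ q) + K2%:E * w `^ q)).
    by rewrite leeD// lee_wpmul2l// lee_fin powR_ge0.
  have CK0 : 0 <= (`|CE| `^ q * K1)%:E by rewrite lee_fin mulr_ge0 ?powR_ge0.
  rewrite muleA -EFinM ge0_muleDl ?lee_fin//.
  by rewrite leeD// lee_wpmul2l// ?lee_fin// ?leeDl ?leeDr ?poweR_ge0.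
have : 'N[nu]_(q%:E)[v] <= ((2 * M) `^ q^-1)%:E * (g + w).
  (* Each of the two powers is at most that of [g + w]; taking [q]-th roots in [sumle] then gives
     the bound by norms. *)
  have gw : g `^ q + w `^ q <= 2%:E * (g + w) `^ q.
    by rewrite mule_natl mule2n leeD// ge0_le_poweR ?(ltW q0) ?leeDl ?leeDr.
  rewrite unlock.
  have qV0 : (0 <= q^-1)%R by rewrite invr_ge0 ltW.
  apply: (le_trans (ge0_le_poweR qV0 _ sumle)).
    by apply: integral_ge0 => x _; exact: poweR_ge0.
  apply: (@le_trans _ _ (((2 * M)%:E * (g + w) `^ q) `^ q^-1)).
    apply: ge0_le_poweR => //.
      by rewrite mule_ge0 ?lee_fin// adde_ge0 ?poweR_ge0.
    by rewrite [(2 * M)%R]mulrC (EFinM M) -muleA lee_wpmul2l ?lee_fin.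
  rewrite (poweRM _ _ (poweR_ge0 _ _)) ?lee_fin//; last by rewrite mulr_ge0.
  rewrite poweR_EFin -poweRrM.
  by rewrite mulfV ?gt_eqF// poweRe1// adde_ge0.
move=> /le_trans; apply; rewrite lee_wpmul2r ?adde_ge0//.
by rewrite lee_fin lerDl.
Qed.
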